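(* Let $C(n,p)$ be a cycle permutation graph. Then $\chi'_{N}(C(n,p))\leq 6$.
   Context: A cycle permutation graph is a cubic graph of order $2n$ that admits a $2$-factor consisting of two disjoint chordless $n$-cycles. For a permutation $p$ of $\{0,\dots,n-1\}$, $C(n,p)$ denotes the graph with vertices $u_0,\dots,u_{n-1}$ forming a cycle (edges $u_iu_{i+1}$), $v_0,\dots,v_{n-1}$ forming a cycle (edges $v_iv_{i+1}$), indices modulo $n$, and the edges $v_iu_{p(i)}$. A $k$-edge-coloring is a proper edge-coloring with colors from $\{1,\dots,k\}$. For an edge-coloring $c$ and a vertex $v$, let $S_c(v)$ be the set of colors on edges incident with $v$. An edge $uv$ of a cubic graph is poor if $|S_c(u)\cup S_c(v)|=3$, rich if $|S_c(u)\cup S_c(v)|=5$, and normal if it is poor or rich. An edge-coloring is normal if every edge is normal. $\chi'_N(G)$ is the smallest $k$ such that $G$ admits a normal $k$-edge-coloring. *)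

(* Defs.v *)
From mathcomp Require Import all_boot all_fingroup.

Set Implicit Arguments.
Unset Strict Implicit.
Unset Printing Implicit Defensive.

Record cubic_graph := CubicGraph {
  vertex :> finType;
  adj : rel vertex;
  adj_sym : symmetric adj;
  adj_irrefl : irreflexive adj;
  adj_cubic : forall x, #|[set y | adj x y]| = 3
}.

Definition edge_set (G : cubic_graph) : {set {set G}} :=
  [set [set x; y] | x in G, y in G & adj x y].

Notation edge G := {e : {set vertex G} | e \in edge_set G}.

Section EdgeColoring.

Variables (G : cubic_graph) (k : nat).

(* The colors 1, ..., k are encoded as 0, ..., k - 1. *)
Variable c : {ffun edge G -> 'I_k}.

Definition proper_coloring : bool :=
  [forall e : edge G, forall f : edge G,
    (e != f) && ~~ [disjoint val e & val f] ==> (c e != c f)].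

Definition colors_at (v : G) : {set 'I_k} :=
  [set c e | e : edge G & v \in val e].

Definition poor (u v : G) : bool := #|colors_at u :|: colors_at v| == 3.

Definition rich (u v : G) : bool := #|colors_at u :|: colors_at v| == 5.

Definition normal_coloring : bool :=
  proper_coloring &&
  [forall u : G, forall v : G, adj u v ==> poor u v || rich u v].

End EdgeColoring.

Definition normal_colorable (G : cubic_graph) (k : nat) : bool :=
  [exists c : {ffun edge G -> 'I_k}, normal_coloring c].

Lemma in_edge_set (G : cubic_graph) (x y : G) :
  adj x y -> [set x; y] \in edge_set G.
Proof. by move=> xy; apply/imset2P; exists x y; rewrite ?inE. Qed.

Lemma edge_at (G : cubic_graph) (e : {set G}) (x : G) :
  e \in edge_set G -> x \in e -> exists2 y, adj x y & e = [set x; y].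
Proof.
case/imset2P=> a b _; rewrite inE => ab ->.
rewrite !inE => /orP[] /eqP ->; first by exists b.
by exists a; rewrite 1?adj_sym // setUC.
Qed.

Lemma card_edges_at (G : cubic_graph) (x : G) :
  #|[set e : edge G | x \in val e]| = 3.
Proof.
rewrite -(adj_cubic x) -(card_imset _ val_inj).
rewrite -(@card_in_imset _ _ (fun y => [set x; y])); last first.
  move=> y z; rewrite !inE => xy xz /setP/(_ y); rewrite !inE eqxx orbT.
  case/esym/orP=> /eqP // yx.
  by move: xy; rewrite yx adj_irrefl.
apply: eq_card => e; apply/imsetP/imsetP => [[f]|[y]].
  rewrite inE => xf ->; have [y xy ->] := edge_at (valP f) xf.
  by exists y; rewrite ?inE.
rewrite inE => xy ->; exists (Sub [set x; y] (in_edge_set xy)) => //.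
by rewrite inE /= !inE eqxx.
Qed.

(* Giving all edges distinct colors makes every edge rich. *)
Lemma normal_colorable_edges (G : cubic_graph) :
  exists k, normal_colorable G k.
Proof.
exists #|{: edge G}|; apply/existsP; exists [ffun e => enum_rank e].
apply/andP; split.
  apply/forallP=> e; apply/forallP=> f; apply/implyP=> /andP[ef _].
  by rewrite !ffunE (inj_eq enum_rank_inj).
apply/forallP=> u; apply/forallP=> v; apply/implyP=> uv.
have uNv : u != v by apply: contraTneq uv => ->; rewrite adj_irrefl.
apply/orP; right; rewrite /rich.
have E (x : G) : colors_at [ffun e : edge G => enum_rank e] x
    = enum_rank @: [set e : edge G | x \in val e].
  rewrite /colors_at; apply/setP=> i; apply/imsetP/imsetP => -[e]; rewrite inE => xe ->;
  by exists e; rewrite ?inE ?ffunE.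
rewrite !E -imsetU (card_imset _ enum_rank_inj) cardsU !card_edges_at.
suff -> : [set e : edge G | u \in val e] :&: [set e : edge G | v \in val e]
    = [set Sub [set u; v] (in_edge_set uv)] by rewrite cards1.
apply/setP=> e; rewrite !inE; apply/andP/eqP => [[ue ve]|->]; last first.
  by rewrite /= !inE !eqxx orbT.
apply: val_inj => /=; have [y uy ee] := edge_at (valP e) ue.
move: ve; rewrite [val e]ee !inE eq_sym (negPf uNv) /= => /eqP vy.
by rewrite vy; exact: ee.
Qed.

Definition normal_chromatic_index (G : cubic_graph) : nat :=
  ex_minn (normal_colorable_edges G).

(* [inl i] is the vertex u_i and [inr i] is the vertex v_i. *)
Definition cp_adj (n : nat) (p : 'S_n) : rel ('I_n + 'I_n) :=
  fun x y => match x, y with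
  | inl i, inl j | inr i, inr j => (j == ordS i) || (i == ordS j)
  | inr i, inl j | inl j, inr i => j == p i
  end.

Lemma cp_adj_sym n (p : 'S_n) : symmetric (cp_adj p).
Proof. by move=> [i|i] [j|j] //=; rewrite orbC. Qed.

Lemma ordS_neq n (i : 'I_n) : 1 < n -> ordS i != i.
Proof.
move=> n1; apply/eqP=> /(congr1 val) /=.
have := ltn_ord i; rewrite leq_eqVlt => /orP[/eqP ni|lt].
  by rewrite ni modnn => i0; move: n1; rewrite -ni -i0.
by rewrite modn_small // => /eqP; rewrite -[X in _ == X]addn0 -addn1 eqn_add2l.
Qed.

Lemma ordS_neq_pred n (i : 'I_n) : 2 < n -> ordS i != ord_pred i.
Proof.
move=> n2; rewrite -(inj_eq (can_inj (@ordSK n))) ord_predK.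
apply/eqP=> /(congr1 val) /=.
have := ltn_ord i; rewrite leq_eqVlt => /orP[/eqP ni|lt].
  rewrite ni modnn modn_small; last exact: ltn_trans n2.
  by move=> i0; move: n2; rewrite -ni -i0.
rewrite (modn_small lt); move: lt; rewrite leq_eqVlt => /orP[/eqP ni|lt].
  by rewrite ni modnn => i0; move: n2; rewrite -ni -i0.
by rewrite modn_small // => /eqP; rewrite -[X in _ == X]addn0 -addn2 eqn_add2l.
Qed.

Lemma cp_adj_irrefl n (p : 'S_n) : 2 < n -> irreflexive (cp_adj p).
Proof.
by move=> n2 [i|i] /=; rewrite orbb eq_sym; apply/negbTE/ordS_neq/ltnW.
Qed.

Lemma cp_adj_cubic n (p : 'S_n) : 2 < n ->
  forall x, #|[set y | cp_adj p x y]| = 3.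
Proof.
move=> n2 x.
have H (f : 'I_n -> 'I_n + 'I_n) z i : injective f -> (forall j, z != f j) ->
    #|[set z; f (ordS i); f (ord_pred i)]| = 3.
  move=> fi zf; rewrite -setUA !cardsU1 cards1 !inE !(negPf (zf _)) (inj_eq fi).
  by rewrite (negPf (ordS_neq_pred _ n2)).
have K (i j : 'I_n) : (i == ordS j) = (j == ord_pred i).
  by apply/eqP/eqP=> ->; rewrite ?ordSK ?ord_predK.
have L (i j : 'I_n) : (inl i == inl j :> 'I_n + 'I_n) = (i == j) by [].
have R (i j : 'I_n) : (inr i == inr j :> 'I_n + 'I_n) = (i == j) by [].
case: x => i.
  rewrite -(H inl (inr (p^-1%g i)) i) //; last by move=> a b [].
  apply: eq_card => -[] j; rewrite !inE /cp_adj ?L ?R /= ?orbF.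
    by rewrite (K i j).
  by apply/eqP/eqP => ->; rewrite ?permK ?permKV.
rewrite -(H inr (inl (p i)) i) //; last by move=> a b [].
apply: eq_card => -[] j; rewrite !inE /cp_adj ?L ?R /= ?orbF //.
by rewrite (K i j).
Qed.

(* C(n, p); for n <= 2 the cycles would degenerate to loops or multiple edges,
   so that the graph would not be a simple cubic graph. *)
Definition cycle_permutation_graph (n : nat) (n_gt2 : 2 < n) (p : 'S_n) :
    cubic_graph :=
  CubicGraph (@cp_adj_sym n p) (cp_adj_irrefl p n_gt2) (cp_adj_cubic p n_gt2).

(* Main.v *)
Require Import Defs.
From mathcomp Require Import all_boot all_fingroup.
From mathcomp Require Import zify.

(** If n is even, color both rims alternately 0, 1 and all spokes 2.  If n is
odd, delete a spoke e: the rims then have an even number of remaining spokes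
and the rest of the graph is colored as before, the two rim edges at an end of
e both getting color 0.  Read the colors 0, 1, 2 as elements of Z_2^2 and let
c + 3 be the color c shifted by a third coordinate.  Choose another spoke f
whose ends are at distance at least 2 from those of e on both rims, and shift
along the cycle formed by e, f and one arc of each rim.  Every vertex off e now
sees a line of the Fano plane; color e with 5, which makes both of its ends see
{0, 3, 5}: e is poor and the four rim edges next to it are rich.  Such an f
exists for n > 5 by counting, and for n = 5 it fails to exist for every e only
in the Petersen graph, which has a normal 5-edge-coloring.  The prism n = 3 is
3-edge-colorable. *)

Set Implicit Arguments.
Unset Strict Implicit.
Unset Printing Implicit Defensive.

(** * Edge colorings from the color lists around vertices *)

(* [s] and [t] list the colors at the two ends of an edge. *)
Definition normal_triples (s t : seq nat) : bool :=
  size (undup (s ++ t)) \in [:: 3; 5].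

Lemma uniq_map_inj (T U : eqType) (f : T -> U) (s : seq T) :
  uniq [seq f x | x <- s] -> {in s &, injective f}.
Proof.
elim: s => // z s IHs /= /andP[zNs us] x y; rewrite !inE.
move=> /predU1P[->|xs] /predU1P[->|ys] // fxy; last exact: IHs.
  by rewrite fxy map_f in zNs.
by rewrite -fxy map_f in zNs.
Qed.

Lemma edge_ends (G : cubic_graph) (e : edge G) :
  exists xy : G * G, adj xy.1 xy.2 && (val e == [set xy.1; xy.2]).
Proof.
case/imset2P: (valP e) => x y _; rewrite inE => /andP[_ xy] ->.
by exists (x, y); rewrite xy eqxx.
Qed.

Section ColoringFromNeighbours.

Variables (G : cubic_graph) (k : nat) (col : G -> G -> nat) (nb : G -> seq G).
Hypotheses (col_sym : forall x y, col x y = col y x)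
  (nbE : forall x, nb x =i adj x).

Let cols x := [seq col x y | y <- nb x].

Hypotheses (cols_lt : forall x, all (fun i => i < k.+1) (cols x))
  (cols_uniq : forall x, uniq (cols x))
  (cols_normal : forall x y, adj x y -> normal_triples (cols x) (cols y)).

(** An edge is read in a chosen orientation; symmetry of [col] makes the choice irrelevant. *)
Let c : {ffun edge G -> 'I_k.+1} :=
  [ffun e => let xy := xchoose (edge_ends e) in inord (col xy.1 xy.2)].

Let c_edge e x y : val e = [set x; y] -> c e = inord (col x y).
Proof.
rewrite ffunE; set ab := xchoose _; move=> exy.
have /andP[aab /eqP eab] : adj ab.1 ab.2 && (val e == [set ab.1; ab.2]).
  exact: xchooseP (edge_ends e).
move: aab eab; rewrite exy; case: ab => a b /= aab /setP eab; congr inord.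
have aNb : a != b by apply: contraTneq aab => ->; rewrite adj_irrefl.
move: (eab a) (eab b) (eab x) (eab y); rewrite !inE !eqxx ?orbT /=.
move=> /orP[]/eqP ? /orP[]/eqP ?; subst => //; rewrite ?eqxx // in aNb *.
Qed.

Let mem_cols x i : (i \in colors_at c x) = (i \in [seq inord j | j <- cols x]).
Proof.
rewrite -map_comp; apply/imsetP/mapP => -[e].
  rewrite inE => xe ->; have [y xy ee] := edge_at (valP e) xe.
  by exists y; rewrite ?nbE //= (c_edge ee).
rewrite nbE => xe ->; exists (Sub [set x; e] (in_edge_set xe)).
  by rewrite inE /= !inE eqxx.
by rewrite (@c_edge _ x e).
Qed.

Lemma normal_colorable_of_cols : normal_colorable G k.+1.
Proof.
apply/existsP; exists c; apply/andP; split.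
  apply/forallP=> e; apply/forallP=> f; apply/implyP=> /andP[eNf].
  rewrite -setI_eq0 => /set0Pn[x]; rewrite inE => /andP[xe xf].
  have [y xy ee] := edge_at (valP e) xe; have [z xz ef] := edge_at (valP f) xf.
  rewrite (c_edge ee) (c_edge ef).
  apply: contraNneq eNf => /(congr1 val) /=.
  have lt w : adj x w -> col x w < k.+1.
    by move=> xw; apply: (allP (cols_lt x)); apply: map_f; rewrite nbE.
  rewrite !inordK ?lt // => cyz.
  have inj := uniq_map_inj (cols_uniq x).
  by apply/eqP/val_inj; rewrite ee ef (inj _ _ _ _ cyz) ?nbE.
apply/forallP=> x; apply/forallP=> y; apply/implyP=> xy.
suff E : #|colors_at c x :|: colors_at c y| = size (undup (cols x ++ cols y)).
  by rewrite /poor /rich E; move: (cols_normal xy);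
    rewrite /normal_triples !inE.
transitivity #|[seq inord j : 'I_k.+1 | j <- undup (cols x ++ cols y)]|.
  apply: eq_card => i; rewrite inE !mem_cols -mem_cat -map_cat.
  by apply/mapP/mapP => -[j jc ->]; exists j => //; move: jc; rewrite mem_undup.
rewrite (card_uniqP _) ?size_map // map_inj_in_uniq ?undup_uniq // => i j.
have lt l : l \in undup (cols x ++ cols y) -> l < k.+1.
  rewrite mem_undup mem_cat => /orP[] lc; exact: (allP (cols_lt _) _ lc).
by move=> /lt ik /lt jk /(congr1 val); rewrite /= !inordK.
Qed.

End ColoringFromNeighbours.

(** * Colorings of the two rims and the spokes *)

(* [a x] is the color of the rim edge from [x] to [ordS x], [s x] that of the
   spoke at [x]. *)
Definition triple (n : nat) (a s : 'I_n -> nat) (x : 'I_n) : seq nat :=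
  [:: a (ord_pred x); a x; s x].

Definition normal_rim (n k : nat) (a s : 'I_n -> nat) : Prop :=
  forall x, [/\ all (fun i => i < k) (triple a s x), uniq (triple a s x)
    & normal_triples (triple a s x) (triple a s (ordS x))].

Lemma normal_triplesC : commutative normal_triples.
Proof.
move=> s t; rewrite /normal_triples.
suff /perm_undup/perm_size -> : s ++ t =i t ++ s by [].
by move=> i; rewrite !mem_cat orbC.
Qed.

Section RimColors.

Variables (n : nat) (n_gt2 : 2 < n) (p : 'S_n) (k : nat).
Variables (au su av sv : 'I_n -> nat).
Hypothesis spokeE : forall i, su (p i) = sv i.

Let G := cycle_permutation_graph n_gt2 p.

(** The final 0 is a dummy for non-adjacent vertices. The two tests exclude each other because
    [2 < n], whence the symmetry. *)
Let rim_col (a : 'I_n -> nat) i j :=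
  if j == ordS i then a i else if i == ordS j then a j else 0.

Let ordS2 (i : 'I_n) : ordS (ordS i) == i = false.
Proof.
apply/negbTE; rewrite -(can_eq (@ord_predK n)) ordSK; exact: ordS_neq_pred.
Qed.

Let rim_colC a i j : rim_col a i j = rim_col a j i.
Proof. by rewrite /rim_col; case: eqP => [->|] //; rewrite eq_sym ordS2. Qed.

Let rim_colS a i : rim_col a i (ordS i) = a i.
Proof. by rewrite /rim_col eqxx. Qed.

Let col (x y : G) : nat :=
  match x, y with
  | inl i, inl j => rim_col au i j
  | inr i, inr j => rim_col av i j
  | inr i, inl _ | inl _, inr i => sv i
  end.

Let nb (x : G) : seq G :=
  match x with
  | inl i => [:: inl (ord_pred i); inl (ordS i); inr (p^-1%g i)]
  | inr i => [:: inr (ord_pred i); inr (ordS i); inl (p i)]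
  end.

Let nbE x : nb x =i adj x.
Proof.
have K (i j : 'I_n) : (j == ord_pred i) = (i == ordS j).
  by apply/eqP/eqP=> ->; rewrite ?ordSK ?ord_predK.
have L (i j : 'I_n) : (inl i == inl j :> 'I_n + 'I_n) = (i == j) by [].
have R (i j : 'I_n) : (inr i == inr j :> 'I_n + 'I_n) = (i == j) by [].
case: x => i [] j; rewrite !inE ?L ?R /= [RHS]/in_mem /= ?orbF -?K 1?orbC //.
by apply/eqP/eqP => ->; rewrite ?permK ?permKV.
Qed.

Let colsE x : [seq col x y | y <- nb x] =
  match x with inl i => triple au su i | inr i => triple av sv i end.
Proof.
by case: x => i /=; rewrite rim_colS rim_colC -{2}(ord_predK i) rim_colS //=
  -spokeE permKV.
Qed.

Hypotheses (u_normal : normal_rim k.+1 au su) (v_normal : normal_rim k.+1 av sv)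
  (spoke_normal : forall i,
    normal_triples (triple av sv i) (triple au su (p i))).

Lemma normal_colorable_of_rims : normal_colorable G k.+1.
Proof.
apply: (@normal_colorable_of_cols _ _ col nb) => //.
- by move=> [i|i] [j|j] //=; rewrite rim_colC.
- by case=> i; rewrite colsE; [case: (u_normal i) | case: (v_normal i)].
- by case=> i; rewrite colsE; [case: (u_normal i) | case: (v_normal i)].
move=> x y; rewrite !colsE; case: x y => i [] j /=.
- by case/orP=> /eqP ->; [|rewrite normal_triplesC];
    [case: (u_normal i) | case: (u_normal j)].
- by move/eqP->; rewrite normal_triplesC.
- by move/eqP->.
by case/orP=> /eqP ->; [|rewrite normal_triplesC];
  [case: (v_normal i) | case: (v_normal j)].
Qed.

End RimColors.

(** * Positions along a rim, counted from a base vertex *)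

Section RelativePositions.

Variable n : nat.
Implicit Types (i x : 'I_n) (E S : nat -> nat).

(** Adding [n - i] before reducing avoids truncated subtraction. *)
Definition relpos i x : nat := (x + (n - i)) %% n.

Lemma relpos_lt i x : relpos i x < n.
Proof. by rewrite ltn_mod (leq_ltn_trans _ (ltn_ord i)). Qed.

Lemma relposS i x : relpos i (ordS x) = (relpos i x).+1 %% n.
Proof. by rewrite /relpos /= modnDml addSn -[in RHS]addn1 modnDml addn1. Qed.

Lemma relpos_inj i : injective (relpos i).
Proof.
move=> x y /eqP; rewrite eqn_modDr !modn_small // => /eqP; exact: val_inj.
Qed.

Lemma relpos_eq0 i x : (relpos i x == 0) = (x == i).
Proof.
have i0 : relpos i i = 0 by rewrite /relpos subnKC ?modnn // ltnW.
by rewrite -{1}i0 (inj_eq (@relpos_inj i)).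
Qed.

Lemma relpos_pred i x : relpos i (ord_pred x) = (relpos i x + n.-1) %% n.
Proof.
have n0 : 0 < n by apply: leq_ltn_trans (ltn_ord i).
rewrite -{2}(ord_predK x) relposS modnDml addSnnS prednK // modnDr.
by rewrite modn_small ?relpos_lt.
Qed.

(* The colors at position [t.+1]: stepping forward avoids a truncated
   predecessor. *)
Definition rel_triple E S t := [:: E t; E (t.+1 %% n); S (t.+1 %% n)].

Lemma triple_relpos E S i x :
  triple (E \o relpos i) (S \o relpos i) x =
    rel_triple E S (relpos i (ord_pred x)).
Proof. by rewrite /rel_triple -relposS ord_predK. Qed.

Lemma normal_rim_relpos k E S i :
    (forall t, t < n -> [/\ all (fun c => c < k) (rel_triple E S t),
      uniq (rel_triple E S t)
      & normal_triples (rel_triple E S t) (rel_triple E S (t.+1 %% n))]) ->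
  normal_rim k (E \o relpos i) (S \o relpos i).
Proof.
by move=> ok x; rewrite -(ord_predK x) !triple_relpos !ordSK relposS;
  apply/ok/relpos_lt.
Qed.

End RelativePositions.

(** * The switched coloring of a rim for odd order *)

(* Positions on a rim are counted from the end of e; [j] is that of the end of
   f, and the switched arc runs from 0 to [j]. *)
Definition switch_edge (j t : nat) : nat := odd t + 3 * (t < j).
Definition switch_spoke (j t : nat) : nat := 2 + 3 * ((t == 0) || (t == j)).

Definition switch_triple n j t : seq nat :=
  rel_triple n (switch_edge j) (switch_spoke j) t.

(** The cases for the vertex at [t.+1] modulo [n]: the end of e, the inside of the arc, the end of
    f, the rest. As [n] is odd, the last rim edge before e keeps color 0. *)
Lemma switch_tripleE n j t : odd n -> 1 < j -> j.+1 < n -> t < n ->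
  switch_triple n j t =
    if t.+1 == n then [:: 0; 3; 5]
    else if t.+1 < j then [:: odd t + 3; ~~ odd t + 3; 2]
    else if t.+1 == j then [:: odd t + 3; ~~ odd t : nat; 5]
    else [:: odd t : nat; ~~ odd t : nat; 2].
Proof.
move=> n_odd j1 jn tn.
rewrite /switch_triple /rel_triple /switch_edge /switch_spoke.
have [tn1|tn1] := eqVneq t.+1 n.
  have -> : odd t = false by move: n_odd; rewrite -tn1 /=; case: odd.
  by rewrite tn1 modnn /= leqNgt (ltnW jn) ltnW.
rewrite modn_small /=; last by rewrite ltn_neqAle tn1.
have [tj|tj|tj] := ltngtP t.+1 j.
all: by rewrite /= ?muln1 ?muln0 ?addn0.
Qed.

(** The bounds on [j] keep f away from e: next to {0, 3, 5}, the triple {1, 3, 5} or {0, 4, 5} at f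
    would make a union of four colors. *)
Lemma normal_switch_rim n j (i : 'I_n) : odd n -> 1 < j -> j.+1 < n ->
  normal_rim 6 (switch_edge j \o relpos i) (switch_spoke j \o relpos i).
Proof.
move=> n_odd j1 jn; apply: normal_rim_relpos => t tn.
have n0 : 0 < n by apply: leq_ltn_trans tn.
rewrite -!/(switch_triple _ _ _) !switch_tripleE ?ltn_mod //.
have [tn1|tn1] := eqVneq t.+1 n.
  by rewrite tn1 modnn j1; case: eqP => [n1|] //; lia.
rewrite modn_small; last by rewrite ltn_neqAle tn1.
have [tj|tj|tj] := ltngtP t.+1 j; have [n2|n2] := eqVneq t.+2 n.
all: try lia.
all: by rewrite /= ?negbK; case: (odd t); do 2?case: ifP.
Qed.

(** * Switchable spokes, even order and triangles *)

Section Cases.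

Variables (n : nat) (n_gt2 : 2 < n) (p : 'S_n).

Let G := cycle_permutation_graph n_gt2 p.

Definition switchable (i j : 'I_n) : bool :=
  [&& 1 < relpos i j, (relpos i j).+1 < n,
    1 < relpos (p i) (p j) & (relpos (p i) (p j)).+1 < n].

Lemma normal_colorable_switchable i j :
  odd n -> switchable i j -> normal_colorable G 6.
Proof.
move=> n_odd /and4P[v1 vn u1 un].
set u := relpos (p i) (p j) in u1 un; set v := relpos i j in v1 vn.
apply: (@normal_colorable_of_rims _ _ _ _
  (switch_edge u \o relpos (p i)) (switch_spoke u \o relpos (p i))
  (switch_edge v \o relpos i) (switch_spoke v \o relpos i)).
- move=> x; rewrite /switch_spoke /= !relpos_eq0 /u /v.
  by rewrite !(inj_eq (@relpos_inj _ _)) !(inj_eq perm_inj).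
- exact: normal_switch_rim.
- exact: normal_switch_rim.
move=> x; rewrite !triple_relpos -!/(switch_triple _ _ _).
rewrite !switch_tripleE ?relpos_lt //.
(* Turns the tests on the predecessor's position into tests for being an end of e or f. *)
have S k (y : 'I_n) m : m.+1 < n -> 1 < m ->
    ((relpos k (ord_pred y)).+1 == n = (relpos k y == 0)) *
    (((relpos k (ord_pred y)).+1 == m) = (relpos k y == m)).
  rewrite -{2 4}(ord_predK y) relposS; have := relpos_lt k (ord_pred y).
  rewrite leq_eqVlt => /orP[/eqP->|lt]; first by rewrite modnn eqxx; split; lia.
  by rewrite modn_small //; split; lia.
rewrite !(S _ _ _ un u1) !(S _ _ _ vn v1) !relpos_eq0 /u /v.
rewrite !(inj_eq (@relpos_inj _ _)) !(inj_eq perm_inj).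
(* Both ends of e see {0, 3, 5}. Each end of f sees {1, 3, 5} or {0, 4, 5}, each end of another
   spoke {0, 1, 2} or {2, 3, 4}: two such lines coincide or share only the spoke's color. *)
by case: eqP => // _; case: (x == j); do 2?case: ifP => _;
  do 2?case: odd.
Qed.

Lemma normal_colorable_three_colors (au su av sv : 'I_n -> nat) :
    (forall i, su (p i) = sv i) ->
    (forall i, perm_eq (triple au su i) [:: 0; 1; 2]) ->
    (forall i, perm_eq (triple av sv i) [:: 0; 1; 2]) ->
  normal_colorable G 6.
Proof.
move=> spokeE u3 v3.
have poor3 s t : perm_eq s [:: 0; 1; 2] -> perm_eq t [:: 0; 1; 2] ->
    normal_triples s t.
  move=> /perm_mem s3 /perm_mem t3; rewrite /normal_triples.
  suff /perm_undup/perm_size -> : s ++ t =i [:: 0; 1; 2] by [].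
  by move=> i; rewrite mem_cat s3 t3 orbb.
have rim (a s : 'I_n -> nat) :
    (forall i, perm_eq (triple a s i) [:: 0; 1; 2]) ->
    normal_rim 6 a s.
  move=> as3 i; split; last exact: poor3; first by rewrite (perm_all _ (as3 i)).
  by rewrite (perm_uniq (as3 i)).
apply: (normal_colorable_of_rims n_gt2 spokeE (rim _ _ u3) (rim _ _ v3)) => i.
exact: poor3.
Qed.

Lemma normal_colorable_even : ~~ odd n -> normal_colorable G 6.
Proof.
move=> n_even; pose a (i : 'I_n) : nat := odd i; pose s (i : 'I_n) := 2.
suff as3 i : perm_eq (triple a s i) [:: 0; 1; 2].
  exact: (@normal_colorable_three_colors a s a s).
rewrite /triple -{2}(ord_predK i) /a /s; move: (ord_pred i) => {}i.
suff -> : odd (ordS i) = ~~ odd i by case: (odd i).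
rewrite /=; have := ltn_ord i; rewrite leq_eqVlt => /orP[/eqP e|lt].
  by have := congr1 odd e; rewrite /= (negbTE n_even) => ->; rewrite e modnn.
by rewrite modn_small.
Qed.

(** Each spoke shares its color with the rim edges opposite its ends in the two triangles. *)
Lemma normal_colorable_triangles : n = 3 -> normal_colorable G 6.
Proof.
move=> n3.
have inj3 (q : 'I_n -> nat) : injective q -> (forall i, q i < 3) ->
    forall i, perm_eq (triple (q \o @ord_pred n) q i) [:: 0; 1; 2].
  move=> qi q3 i.
  have pNi : ord_pred i != i.
    by rewrite -(can_eq (@ordSK n)) ord_predK eq_sym ordS_neq // ltnW.
  have ppNp : ord_pred (ord_pred i) != ord_pred i.
    by rewrite (can_eq (@ord_predK n)).
  have ppNi : ord_pred (ord_pred i) != i.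
    by rewrite eq_sym -{1}(ord_predK i) ordS_neq_pred.
  have tr_uniq : uniq (triple (q \o @ord_pred n) q i).
    by rewrite /= !inE !(inj_eq qi) negb_or ppNp ppNi pNi.
  have tr_sub : {subset triple (q \o @ord_pred n) q i <= iota 0 3}.
    by move=> c; rewrite mem_iota !inE => /or3P[] /eqP -> /=.
  by apply: uniq_perm => //; case: (uniq_min_size tr_uniq tr_sub _).
apply: (@normal_colorable_three_colors (val \o @ord_pred n) val
  (val \o p \o @ord_pred n) (val \o p)) => //.
- by apply: inj3 => [|i]; [exact: val_inj | rewrite -[X in _ < X]n3 ltn_ord].
apply: inj3 => [|i]; last by rewrite -[X in _ < X]n3 ltn_ord.
by apply: inj_comp; [exact: val_inj | exact: perm_inj].
Qed.

Lemma exists_switchable : 5 < n -> exists i j, switchable i j.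
Proof.
move=> n_gt5; have n0 : 0 < n by apply: leq_trans n_gt2.
have relpos1 (x y : 'I_n) : y != x -> y != ordS x -> y != ord_pred x ->
    1 < relpos x y /\ (relpos x y).+1 < n.
  have relpos_self : relpos x x = 0 by apply/eqP; rewrite relpos_eq0.
  rewrite -!(inj_eq (@relpos_inj _ x)) relposS relpos_pred relpos_self.
  rewrite add0n !modn_small ?ltn_predL //; last exact: ltnW.
  by have := relpos_lt x y; lia.
pose i := Ordinal n0.
(* The spoke at [i] and those ending next to it on either rim: at most five. *)
pose bad :=
  [:: i; ordS i; ord_pred i; p^-1%g (ordS (p i)); p^-1%g (ord_pred (p i))].
have [j jNbad] : exists j, j \notin bad.
  apply/existsP; rewrite -negb_forall.
  apply: contraTN n_gt5 => /forallP all_bad.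
  rewrite -leqNgt -(card_ord n) (leq_trans _ (card_size bad)) //.
  by apply/subset_leq_card/subsetP=> x _.
exists i, j; move: jNbad.
rewrite !inE !negb_or -!(can2_eq (permK p) (permKV p)).
case/and5P=> ij iSj iPj uSj uPj.
rewrite /switchable; have [-> ->] := relpos1 _ _ ij iSj iPj.
by have [|-> ->] := relpos1 (p i) (p j) _ uSj uPj; rewrite ?(inj_eq perm_inj).
Qed.

End Cases.

(** * Order five *)

Section Order5.

Variables (n_gt2 : 2 < 5) (p : 'S_5).

(* Label the vertices of the Petersen graph by the 2-subsets of Z_5, adjacent
   when disjoint, and color each edge by the element that its ends avoid; the
   formulas below are this coloring. *)
Lemma normal_colorable_petersen m (a : 'I_5) : m \in [:: 2; 3] ->
    (forall i, p i = (a + m * i) %% 5 :> nat) ->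
  normal_colorable (cycle_permutation_graph n_gt2 p) 6.
Proof.
move=> m23 pE.
have relpos_p i : relpos a (p i) = (m * i) %% 5.
  by rewrite /relpos pE modnDml addnAC subnKC ?modnDl // ltnW.
have relpos0 (i : 'I_5) : relpos ord0 i = i.
  by rewrite /relpos modnDr modn_small.
(* Modulo 5, [m * m] is -1, so [Su] and [Sv] agree along each spoke. The shift [3 * (m - 2)]
   accounts for the u-rim running the other way when [m] is 3. *)
pose Eu t := (m * t + 3 * (m - 2)) %% 5; pose Su t := (m * t + 4) %% 5.
pose Ev t := (4 * t + 1) %% 5; pose Sv t := (4 * t + 4) %% 5.
apply: (@normal_colorable_of_rims _ _ _ _ (Eu \o relpos a) (Su \o relpos a)
  (Ev \o relpos ord0) (Sv \o relpos ord0)).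
- move=> i; rewrite /= relpos_p relpos0 /Su /Sv.
  by move: m23 i; rewrite !inE => /orP[]/eqP-> [[|[|[|[|[]]]]]].
- apply: normal_rim_relpos; rewrite /Eu /Su.
  by move: m23; rewrite !inE => /orP[]/eqP-> [|[|[|[|[]]]]].
- by apply: normal_rim_relpos; do 5?case.
move=> i; rewrite !triple_relpos !relpos_pred relpos_p relpos0 /Eu /Su.
by move: m23 i; rewrite !inE => /orP[]/eqP-> [[|[|[|[|[]]]]]].
Qed.

Let switchable_seq (s : seq nat) (i j : nat) : bool :=
  let v := (j + (5 - i)) %% 5 in
  let u := (nth 0 s j + (5 - nth 0 s i)) %% 5 in
  [&& 1 < v, v.+1 < 5, 1 < u & u.+1 < 5].

Let affine_seq (s : seq nat) (m : nat) : bool :=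
  all (fun i => nth 0 s i == (nth 0 s 0 + m * i) %% 5) (iota 0 5).

(** Without a switchable pair, [p] sends vertices at distance 2 to neighbours, hence the pentagram
    to the pentagon, so it is affine of slope 2 or 3. *)
Let seq5_cases :
  all (fun s => has (fun i => has (switchable_seq s i) (iota 0 5)) (iota 0 5)
                || has (affine_seq s) [:: 2; 3])
      (permutations (iota 0 5)).
Proof. by vm_compute. Qed.

Lemma normal_colorable_order5 :
  normal_colorable (cycle_permutation_graph n_gt2 p) 6.
Proof.
pose s := [seq val (p i) | i <- enum 'I_5].
have nth_s (i : 'I_5) : nth 0 s i = p i.
  by rewrite (nth_map ord0) ?size_enum_ord // nth_ord_enum.
have s_perm : s \in permutations (iota 0 5).
  rewrite mem_permutations -val_enum_ord /s map_comp perm_map //.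
  apply: uniq_perm; rewrite ?(map_inj_uniq perm_inj) ?enum_uniq // => i.
  by rewrite mem_enum -[i](permKV p) map_f ?mem_enum.
case/orP: (allP seq5_cases _ s_perm).
  case/hasP=> i; rewrite mem_iota => i5 /hasP[j].
  rewrite mem_iota => j5.
  rewrite /switchable_seq (nth_s (Ordinal i5)) (nth_s (Ordinal j5)) => sw.
  exact: (@normal_colorable_switchable _ _ _ (Ordinal i5) (Ordinal j5)).
case/hasP=> m m23 /allP pE.
apply: (normal_colorable_petersen m23 (a := p ord0)).
by move=> i; rewrite -!nth_s; apply/eqP/pE; rewrite mem_iota ltn_ord.
Qed.

End Order5.

Theorem theorem5 (n : nat) (n_gt2 : 2 < n) (p : 'S_n) :
  normal_chromatic_index (cycle_permutation_graph n_gt2 p) <= 6.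
Proof.
rewrite /normal_chromatic_index; case: ex_minnP => k _; apply.
have [n_odd|] := boolP (odd n); last exact: normal_colorable_even.
have [n5|nN5] := eqVneq n 5; first by subst n; exact: normal_colorable_order5.
have [n3|nN3] := eqVneq n 3; first exact: normal_colorable_triangles.
have n_gt5 : 5 < n by case: n n_gt2 n_odd nN5 nN3 {p} => [|[|[|[|[|[|n]]]]]].
have [i [j]] := exists_switchable n_gt2 p n_gt5.
exact: normal_colorable_switchable.
Qed.
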